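(* For all integers $p\ge 0$, $q\ge 1$, $i\ge 0$, $j\ge 0$, the generalized Eulerian numbers satisfy $$\frac{A_{p,q}(i,j+1)}{A_{p,q-1}(i,j+1)}\ \le\ \frac{A_{p,q}(i,j)}{A_{p,q-1}(i,j)}\ \le\ \frac{q+j}{q+1+j}\cdot\frac{A_{p,q}(i+1,j)}{A_{p,q-1}(i+1,j)}.$$
   Context: The Euler graph is the infinite directed multigraph with vertex set $\{(i,j): i,j\in\mathbb{Z}_{\ge 0}\}$, having exactly $j+1$ edges from $(i,j)$ to $(i+1,j)$ and exactly $i+1$ edges from $(i,j)$ to $(i,j+1)$, and no other edges. For integers $p,q,i,j\ge 0$, the generalized Eulerian number $A_{p,q}(i,j)$ is the number of directed paths (parallel edges distinguished) from $(p,q)$ to $(p+i,q+j)$ in the Euler graph; $A_{p,q}(0,0)=1$ (the empty path). *)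

(* Defs.v *)
From mathcomp Require Import all_boot all_order all_algebra finmap.
From mathcomp Require Import boolp classical_sets functions cardinality.

Set Implicit Arguments.
Unset Strict Implicit.
Unset Printing Implicit Defensive.

Definition vertex : Type := (nat * nat)%type.

(* Number of edges from v to w in the Euler graph. *)
Definition euler_mult (v w : vertex) : nat :=
  if w == (v.1.+1, v.2) then v.2.+1
  else if w == (v.1, v.2.+1) then v.1.+1
  else 0.

(* A pair (source, target) tagged with the index of one of the parallel edges
   joining them. *)
Definition edge : Type := {vw : vertex * vertex & 'I_(euler_mult vw.1 vw.2)}.

Definition source (e : edge) : vertex := (tag e).1.
Definition target (e : edge) : vertex := (tag e).2.

Fixpoint is_path (v : vertex) (s : seq edge) (w : vertex) : bool :=
  if s is e :: s' then (source e == v) && is_path (target e) s' w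
  else v == w.

Definition paths (v w : vertex) : set (seq edge) :=
  [set s | is_path v s w]%classic.

(* fset_set of an infinite set is empty; finite_paths below shows that this
   case does not occur here. *)
Definition gen_eulerian (p q i j : nat) : nat :=
  #|` fset_set (paths (p, q) (p + i, q + j)%N) |%fset.

Lemma euler_mult_gt0 (v w : vertex) :
  0 < euler_mult v w -> w = (v.1.+1, v.2) \/ w = (v.1, v.2.+1).
Proof.
rewrite /euler_mult; case: eqP => [->|_]; first by left.
by case: eqP => [->|//]; right.
Qed.

Lemma target_sum (e : edge) :
  (target e).1 + (target e).2 = ((source e).1 + (source e).2).+1.
Proof.
case: e => -[v w] /= k; rewrite /source /target /=.
by case: (euler_mult_gt0 (leq_ltn_trans (leq0n k) (ltn_ord k))) => -> //=;
  rewrite ?addnS ?addSn.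
Qed.

Lemma is_path_size v s w :
  is_path v s w -> w.1 + w.2 = v.1 + v.2 + size s.
Proof.
elim: s v => [|e s IHs] v /=; first by move=> /eqP ->; rewrite addn0.
by case/andP => /eqP <- /IHs ->; rewrite target_sum addSnnS.
Qed.

Lemma finite_edges_from (v : vertex) :
  finite_set [set e | source e = v]%classic.
Proof.
pose F w := ((fun k : 'I_(euler_mult v w) =>
  existT (fun vw => 'I_(euler_mult vw.1 vw.2)) (v, w) k : edge) @` setT)%classic.
apply: (@sub_finite_set _ _ (F (v.1.+1, v.2) `|` F (v.1, v.2.+1))%classic).
  case=> -[v' w] /= k /= ev; rewrite /source /= in ev; subst v'.
  have := euler_mult_gt0 (leq_ltn_trans (leq0n k) (ltn_ord k)).
  by case=> ew; subst w; [left | right]; exists k.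
by rewrite finite_setU; split; apply/finite_image/finite_finset.
Qed.

Lemma finite_paths (v w : vertex) : finite_set (paths v w).
Proof.
suff fin n u : finite_set [set s | is_path u s w /\ size s = n]%classic.
  apply: sub_finite_set (fin (w.1 + w.2 - (v.1 + v.2)) v) => s /= sP.
  by split=> //; rewrite (is_path_size sP) addKn.
elim: n u => [|n IHn] u.
  by apply: (@sub_finite_set _ _ [set [::]]%classic) => // s [_ /size0nil ->].
apply: (@sub_finite_set _ _ (\bigcup_(e in [set e | source e = u])
  (cons e @` [set s | is_path (target e) s w /\ size s = n]))%classic).
  case=> [[]//|e s] [/= /andP[/eqP eu sP] [sn]].
  by exists e => //; exists s.
apply: bigcup_finite; first exact: finite_edges_from.
by move=> e _; apply: finite_image.
Qed.

(* Main.v *)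
Require Import Defs.
From mathcomp Require Import all_boot all_order all_algebra.
From mathcomp Require Import finmap classical_sets cardinality.
From mathcomp Require Import zify lra.
Import Order.TTheory GRing.Theory Num.Theory.
Local Open Scope ring_scope.

(** Write A and B for the numbers A_{p,q+1} and A_{p,q}, and r(i,j) = A(i,j) /
    B(i,j).  Splitting a path at its last edge gives
      A(i+1,j+1) = (q+j+3) A(i,j+1) + (p+i+2) A(i+1,j),
      B(i+1,j+1) = (q+j+2) B(i,j+1) + (p+i+2) B(i+1,j).
    The second coefficients agree, so r(i+1,j+1) is a mediant of the fractions
    (q+j+3)/(q+j+2) r(i,j+1) and r(i+1,j), hence lies between them
    ([shift_ratioSS]).  If the first fraction is at most the second,
    this says that
      r(i+1,j+1) <= r(i+1,j)  and  (q+j+3)/(q+j+2) r(i,j+1) <= r(i+1,j+1),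
    which are the two claimed inequalities, the first at (i+1,j) and the second
    at (i,j+1).

    The order of the two fractions follows in turn from the claimed
    inequalities at (i,j): since (q+j+3)/(q+j+2) <= (q+j+2)/(q+j+1),
      (q+j+3)/(q+j+2) r(i,j+1) <= (q+j+2)/(q+j+1) r(i,j) <= r(i+1,j).
    So both inequalities propagate by induction on i + j
    ([shift_ratio_bounds]).  The boundary cases are equalities: r(0,j) = 1, and
    r(i+1,0) = (q+2)/(q+1) r(i,0). *)

Definition path_count (v w : vertex) : nat :=
  #|` fset_set (paths v w)|%fset.

Definition path_seq (v w : vertex) : seq (seq edge) :=
  enum_fset (fset_set (paths v w)).

Definition parallel_edge (u w : vertex) (k : 'I_(euler_mult u w)) : edge :=
  existT (fun vw => 'I_(euler_mult vw.1 vw.2)) (u, w) k.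

Lemma parallel_edge_inj (u w : vertex) : injective (parallel_edge u w).
Proof. by move=> k l /eqP; rewrite /parallel_edge eq_Tagged => /eqP. Qed.

Lemma mem_path_seq (v w : vertex) (s : seq edge) :
  (s \in path_seq v w) = is_path v s w.
Proof.
rewrite /path_seq in_fset_set; last exact: finite_paths.
by apply/idP/idP; rewrite inE.
Qed.

(** Reduces counting paths to exhibiting a list of them, which avoids
    cardinalities of images and products of finite sets. *)
Lemma path_count_size (v w : vertex) (L : seq (seq edge)) :
  uniq L -> (forall s, (s \in L) = is_path v s w) -> path_count v w = size L.
Proof.
move=> uL memL.
apply: perm_size; apply: uniq_perm => //.
by move=> s; rewrite memL; exact: mem_path_seq.
Qed.

Lemma is_path_rcons (v w : vertex) (s : seq edge) (e : edge) :
  is_path v (rcons s e) w = is_path v s (source e) && (target e == w).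
Proof.
elim: s v => [|f s IHs] v /=; first by rewrite eq_sym.
by rewrite IHs andbA.
Qed.

Lemma is_path_mono (v w : vertex) (s : seq edge) :
  is_path v s w -> (v.1 <= w.1)%N /\ (v.2 <= w.2)%N.
Proof.
elim: s v => [|[[a b] k] s IHs] v /=; first by move=> /eqP ->.
case/andP=> /eqP <- /IHs [].
have [] := euler_mult_gt0 (leq_ltn_trans (leq0n k) (ltn_ord k));
  rewrite /source /target /= => -> /=; lia.
Qed.

Lemma path_count_unreachable (v w : vertex) :
  (w.1 < v.1)%N || (w.2 < v.2)%N -> path_count v w = 0%N.
Proof.
move=> h; apply: (@path_count_size v w [::]) => // s.
by apply/esym/negP => /is_path_mono []; lia.
Qed.

Lemma path_count_refl (v : vertex) : path_count v v = 1%N.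
Proof.
apply: (@path_count_size v v [:: [::]]) => // s; rewrite inE.
apply/eqP/idP => [-> /=|/is_path_size]; first exact: eqxx.
by case: s => //= e s; lia.
Qed.

Definition paths_via (v u w : vertex) : seq (seq edge) :=
  [seq rcons s (parallel_edge u w k)
     | s <- path_seq v u, k <- enum 'I_(euler_mult u w)].

Lemma size_paths_via (v u w : vertex) :
  size (paths_via v u w) = (path_count v u * euler_mult u w)%N.
Proof. by rewrite size_allpairs size_enum_ord. Qed.

Lemma paths_via_uniq (v u w : vertex) : uniq (paths_via v u w).
Proof.
apply: allpairs_uniq; [exact: fset_uniq|exact: enum_uniq|].
move=> [s k] [t l] _ _ /rcons_inj /= est.
by rewrite (congr1 fst est : s = t) (parallel_edge_inj _ _ _ _ (congr1 snd est)).
Qed.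

Lemma mem_paths_via (v u w : vertex) (s : seq edge) (e : edge) :
  (rcons s e \in paths_via v u w) =
  [&& is_path v s u, source e == u & target e == w].
Proof.
apply/allpairsP/and3P => [[[t k] /= [ht _ /rcons_inj [-> ->]]]|].
  by rewrite -mem_path_seq ht !eqxx.
case: e => [[a b] k]; rewrite /source /target /= => -[hs /eqP ea /eqP eb].
by subst a b; exists (s, k); rewrite mem_path_seq mem_enum.
Qed.

Lemma nil_paths_via (v u w : vertex) : ([::] \in paths_via v u w) = false.
Proof. by apply/allpairsP => -[[[|e s] k] /= [_ _]]. Qed.

(** The last edge of a nonempty path comes from the left or lower neighbour of
    its end, and removing it leaves an arbitrary path to that neighbour.  On an
    axis the truncated predecessor is [w] itself, and the corresponding term
    vanishes because the graph has no loops, so no case distinction on [w] is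
    needed. *)
Lemma path_count_last_step (v w : vertex) : v != w ->
  path_count v w =
  (path_count v (w.1.-1, w.2) * euler_mult (w.1.-1, w.2) w +
   path_count v (w.1, w.2.-1) * euler_mult (w.1, w.2.-1) w)%N.
Proof.
move=> vw; rewrite -!size_paths_via -size_cat; apply: path_count_size.
  rewrite cat_uniq !paths_via_uniq andbT; apply/hasPn => s.
  case/lastP: s => [|s [[a b] k]]; first by rewrite nil_paths_via.
  (* A path on both lists forces the two predecessors to coincide, so [w] is
     the origin, which no edge enters. *)
  rewrite !mem_paths_via /source /target /= => /and3P[_ /eqP ea /eqP eb].
  subst a b; apply/negP => /and3P[_ /eqP[e1 e2] _].
  have := euler_mult_gt0 (leq_ltn_trans (leq0n k) (ltn_ord k)).
  by case: w vw e1 e2 {s k} => x y /= _ e1 e2 [] eqw; case: eqw; lia.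
move=> s; rewrite mem_cat; case/lastP: s => [|s [[a b] k]].
  by rewrite !nil_paths_via /= (negPf vw).
rewrite !mem_paths_via is_path_rcons /source /target /=.
case: (b =P w) => [eb|_]; last by rewrite !andbF.
subst b; rewrite !andbT.
suff: (a == (w.1.-1, w.2)) || (a == (w.1, w.2.-1)).
  by do 2![case: (a =P _) => [<-|_]] => // _; rewrite ?andbT ?andbF ?orbb ?orbF.
have := euler_mult_gt0 (leq_ltn_trans (leq0n k) (ltn_ord k)).
by case: a {k} => x y /= [] -> /=; rewrite eqxx ?orbT.
Qed.

Lemma euler_multE (a b : nat) :
  (euler_mult (a, b) (a.+1, b) = b.+1) * (euler_mult (a, b) (a, b.+1) = a.+1) *
  (euler_mult (a, b) (a, b) = 0)%N.
Proof.
rewrite /euler_mult /= eqxx !xpair_eqE !eqxx /= !andbT.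
by rewrite !(ltn_eqF (ltnSn _)).
Qed.

Lemma gen_eulerian00 (p q : nat) : gen_eulerian p q 0 0 = 1%N.
Proof. by rewrite /gen_eulerian !addn0; exact: path_count_refl. Qed.

(** Of the two possible last edges, the one from below would leave a path ending
    under its starting height [q], or be a loop when [q = 0]. *)
Lemma gen_eulerianS0 (p q i : nat) :
  gen_eulerian p q i.+1 0 = (q.+1 * gen_eulerian p q i 0)%N.
Proof.
rewrite /gen_eulerian -!/(path_count _ _) addnS addn0.
rewrite path_count_last_step /=; last by apply/eqP => -[]; lia.
rewrite euler_multE mulnC; case: q => [|q] /=; first by rewrite euler_multE muln0 addn0.
by rewrite [X in (_ + X * _)%N]path_count_unreachable ?addn0 //=; lia.
Qed.

Lemma gen_eulerian0S (p q j : nat) :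
  gen_eulerian p q 0 j.+1 = (p.+1 * gen_eulerian p q 0 j)%N.
Proof.
rewrite /gen_eulerian -!/(path_count _ _) addnS addn0.
rewrite path_count_last_step /=; last by apply/eqP => -[]; lia.
rewrite euler_multE [RHS]mulnC; case: p => [|p] /=; first by rewrite euler_multE muln0.
by rewrite [X in (X * _ + _)%N]path_count_unreachable //=; lia.
Qed.

Lemma gen_eulerianSS (p q i j : nat) :
  gen_eulerian p q i.+1 j.+1 =
  ((q + j).+2 * gen_eulerian p q i j.+1 +
   (p + i).+2 * gen_eulerian p q i.+1 j)%N.
Proof.
rewrite /gen_eulerian -!/(path_count _ _) !addnS.
rewrite path_count_last_step /=; last by apply/eqP => -[]; lia.
by rewrite !euler_multE mulnC [(_ * (p + i).+2)%N]mulnC.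
Qed.

Lemma gen_eulerian_gt0 (p q i j : nat) : (0 < gen_eulerian p q i j)%N.
Proof.
elim: i j => [|i IHi] j.
  by elim: j => [|j IHj]; rewrite ?gen_eulerian00 // gen_eulerian0S muln_gt0.
elim: j => [|j IHj]; first by rewrite gen_eulerianS0 muln_gt0 IHi.
by rewrite gen_eulerianSS addn_gt0 !muln_gt0 IHi.
Qed.

Lemma mediant (R : realFieldType) (a b c d : R) : 0 < b -> 0 < d ->
  a / b <= c / d -> a / b <= (a + c) / (b + d) <= c / d.
Proof.
move=> b0 d0; rewrite !ler_pdivlMr ?addr_gt0 // mulrAC ler_pdivrMr // => h.
rewrite ![_ / _ * _]mulrAC !ler_pdivrMr ?addr_gt0 //; apply/andP; split; nra.
Qed.

(** The ratio [r(i,j)], indexed by the smaller of the two starting heights. *)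
Definition shift_ratio (p q i j : nat) : rat :=
  (gen_eulerian p q.+1 i j)%:R / (gen_eulerian p q i j)%:R.

Lemma shift_ratio_gt0 (p q i j : nat) : 0 < shift_ratio p q i j.
Proof. by rewrite divr_gt0 // ltr0n gen_eulerian_gt0. Qed.

(** With no horizontal step, every vertical edge has multiplicity [p + 1]
    whatever the starting height. *)
Lemma shift_ratio0 (p q j : nat) : shift_ratio p q 0 j = 1.
Proof.
rewrite /shift_ratio; suff -> : gen_eulerian p q.+1 0 j = gen_eulerian p q 0 j.
  by rewrite divff // pnatr_eq0 -lt0n gen_eulerian_gt0.
by elim: j => [|j IHj]; rewrite ?gen_eulerian00 // !gen_eulerian0S IHj.
Qed.

Lemma shift_ratioS0 (p q i : nat) :
  shift_ratio p q i.+1 0 = q.+2%:R / q.+1%:R * shift_ratio p q i 0.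
Proof. by rewrite /shift_ratio !gen_eulerianS0 !natrM invfM mulrACA. Qed.

(** The coefficient [p + i + 2] in the recurrence does not depend on the
    starting height, so it cancels from one of the two fractions whose mediant
    is the new ratio. *)
Lemma shift_ratioSS (p q i j : nat) :
  let x := (q + j).+3%:R / (q + j).+2%:R * shift_ratio p q i j.+1 in
  x <= shift_ratio p q i.+1 j ->
  x <= shift_ratio p q i.+1 j.+1 <= shift_ratio p q i.+1 j.
Proof.
have pos a b k : 0 < (k.+1 * gen_eulerian p q a b)%:R :> rat.
  by rewrite ltr0n muln_gt0 gen_eulerian_gt0.
have cancel : shift_ratio p q i.+1 j =
    ((p + i).+2 * gen_eulerian p q.+1 i.+1 j)%:R /
    ((p + i).+2 * gen_eulerian p q i.+1 j)%:R.
  by rewrite !natrM -mulf_div divff ?mul1r // pnatr_eq0.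
rewrite /= /shift_ratio mulf_div -!natrM -/(shift_ratio p q i.+1 j) cancel.
move=> h; have := @mediant _ _ _ _ _ (pos _ _ _) (pos _ _ _) h.
by rewrite -!natrD -(gen_eulerianSS p q.+1) -gen_eulerianSS.
Qed.

(** The two inequalities must be proved together: each new one comes from the
    mediant property, whose hypothesis combines both of them one diagonal
    earlier. *)
Lemma shift_ratio_bounds (p q i j : nat) :
  shift_ratio p q i j.+1 <= shift_ratio p q i j /\
  (q + j).+2%:R / (q + j).+1%:R * shift_ratio p q i j <= shift_ratio p q i.+1 j.
Proof.
have step a b :
    shift_ratio p q a b.+1 <= shift_ratio p q a b ->
    (q + b).+2%:R / (q + b).+1%:R * shift_ratio p q a b
      <= shift_ratio p q a.+1 b ->
    (q + b).+3%:R / (q + b).+2%:R * shift_ratio p q a b.+1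
      <= shift_ratio p q a.+1 b.
  move=> dec inc; apply: le_trans inc; apply: ler_pM dec.
  - by rewrite divr_ge0.
  - exact/ltW/shift_ratio_gt0.
  (* (m+3)/(m+2) <= (m+2)/(m+1) for m = q + b, that is (m+3)(m+1) <= (m+2)^2. *)
  - rewrite ler_pdivlMr ?ltr0n // mulrAC ler_pdivrMr ?ltr0n // -!natrM ler_nat.
    by lia.
have [n] := ubnP (i + j); elim: n i j => // n IHn i j ltn; split.
- case: i ltn => [|i] ltn; first by rewrite !shift_ratio0.
  have [dec inc] := IHn i j ltac:(lia).
  by case/andP: (shift_ratioSS _ _ _ _ (step _ _ dec inc)).
- case: j ltn => [|j] ltn; first by rewrite addn0 shift_ratioS0.
  have [dec inc] := IHn i j ltac:(lia).
  by rewrite addnS; case/andP: (shift_ratioSS _ _ _ _ (step _ _ dec inc)).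
Qed.

Theorem corollary4p2 (p q i j : nat) (hq : (1 <= q)%N) :
  (gen_eulerian p q i j.+1)%:R / (gen_eulerian p (q - 1) i j.+1)%:R
    <= (gen_eulerian p q i j)%:R / (gen_eulerian p (q - 1) i j)%:R :> rat
  /\
  (gen_eulerian p q i j)%:R / (gen_eulerian p (q - 1) i j)%:R
    <= (q + j)%:R / (q + 1 + j)%:R *
       ((gen_eulerian p q i.+1 j)%:R / (gen_eulerian p (q - 1) i.+1 j)%:R)
    :> rat.
Proof.
case: q hq => // q _; rewrite subSS subn0 addn1 !addSn -!/(shift_ratio p q _ _).
have [dec inc] := shift_ratio_bounds p q i j; split=> //.
by rewrite -invf_div mulrC ler_pdivlMr ?divr_gt0 ?ltr0n // mulrC.
Qed.
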